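(* Let $R$ be a ring. The following three conditions are equivalent: (1) $R$ is abelian and $J^{\#}$-clean. (2) For every $a\in R$ there exists a unique idempotent $e^2=e\in R$ such that $a=e+j$ for some $j\in J^{\#}(R)$. (3) $R$ is uniquely clean.
   Context: All rings are associative with identity, not necessarily commutative. $J(R)$ denotes the Jacobson radical of $R$ and $J^{\#}(R)=\{z\in R : z^n\in J(R)\text{ for some } n\ge 1\}$. A ring is abelian if every idempotent is central. A ring $R$ is $J^{\#}$-clean if every element of $R$ is the sum of an idempotent of $R$ and an element of $J^{\#}(R)$. A ring $R$ is uniquely clean if every element of $R$ can be written uniquely as the sum of an idempotent and a unit of $R$. *)

(* Defs.v *)
From mathcomp Require Import all_boot all_algebra classical_sets.

Set Implicit Arguments.
Unset Strict Implicit.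
Unset Printing Implicit Defensive.

Import GRing.Theory.
Local Open Scope ring_scope.
Local Open Scope classical_set_scope.

(* Rings are [pzRingType]: unital and associative, with 1 = 0 allowed.
   [GRing.unit] is only available on nontrivial rings with a decidable unit
   predicate, and ring_quotient's ideals are boolean predicates on nontrivial
   rings, hence the Prop-valued versions below. *)

Definition idem (R : pzRingType) (e : R) : Prop := e ^+ 2 = e.

Definition invertible (R : pzRingType) (u : R) : Prop :=
  exists v : R, u * v = 1 /\ v * u = 1.

Definition left_ideal (R : pzRingType) (I : set R) : Prop :=
  [/\ I 0, forall x y, I x -> I y -> I (x - y) & forall a x, I x -> I (a * x)].

Definition maximal_left_ideal (R : pzRingType) (M : set R) : Prop :=
  [/\ left_ideal M, M <> setT &
      forall I : set R, left_ideal I -> M `<=` I -> I = M \/ I = setT].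

(* The intersection of all maximal left ideals; it is the whole ring when
   R is trivial, as there are then no maximal left ideals. *)
Definition jacobson (R : pzRingType) : set R :=
  [set z : R | forall M : set R, maximal_left_ideal M -> M z].

Definition jsharp (R : pzRingType) : set R :=
  [set z : R | exists n : nat, (1 <= n)%N /\ jacobson (z ^+ n)].

Definition abelian_ring (R : pzRingType) : Prop :=
  forall e : R, idem e -> forall x : R, GRing.comm e x.

Definition jsharp_clean (R : pzRingType) : Prop :=
  forall a : R, exists e j : R, [/\ idem e, jsharp j & a = e + j].

Definition uniquely_clean (R : pzRingType) : Prop :=
  forall a : R, exists! p : R * R,
    [/\ idem p.1, invertible p.2 & a = p.1 + p.2].

(* Main.v *)
Require Import Defs.
From mathcomp Require Import all_boot all_algebra.
From mathcomp Require Import boolp classical_sets.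

Set Implicit Arguments.
Unset Strict Implicit.
Unset Printing Implicit Defensive.

Import GRing.Theory.
Local Open Scope ring_scope.

(** The bridge between the three conditions is the position of idempotents
    and units relative to the Jacobson radical [J].

    Everything known about [J] comes from Jacobson's criterion
    ([jacobsonP]): [z] lies in [J] iff every [1 - r z] is left invertible.
    It makes [1 - z] invertible for [z] in [J], keeps nonzero idempotents out
    of [J], and gives that a unit plus a commuting element of [J#] is a unit
    ([invertible_add_jsharp], a geometric series modulo [J]).

    Abelian and [J#]-clean implies unique idempotents
    ([jsharp_decomposition_unique]): if [a = e + j = f + k], then on the corner
    cut out by [g = e (1 - f)] the element [a] is both [1 + j], a unit, and
    [k], nilpotent modulo [J]; hence [g] is in [J] and vanishes.

    Conversely, uniqueness of the idempotent, for [J#] as well as for units,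
    forces abelianness: [e + e x (1 - e)] is an idempotent that differs
    from [e] by a square-zero element, so the two must agree.

    When the idempotent part modulo [J#] is unique, every unit lies in
    [1 + J#], so the clean decompositions of [a] are exactly the [J#]-clean
    decompositions of [a - 1].  In the other direction, when [R] is uniquely
    clean, every unit lies even in [1 + J] ([invertible_sub1_jacobson]): if
    [u] is a unit, the left ideal generated by [1 - u] contains no nonzero
    idempotent [g], because on the corner [g R] both [u] and [u - 1] would be
    units, giving two clean decompositions; and in a clean abelian ring a left
    ideal without nonzero idempotents is inside [J].  Writing
    [a - 1 = e + u] then gives [a = e + (1 + u)] with [1 + u] in [J]. *)

(** * The Jacobson radical *)

Section Jacobson.
Local Open Scope classical_set_scope.
Variable R : pzRingType.
Implicit Types (I M : set R) (r x z : R).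

Lemma left_idealN I x : left_ideal I -> I x -> I (- x).
Proof. by case=> I0 IB _ Ix; rewrite -sub0r; apply: IB. Qed.

Lemma left_idealD I x y : left_ideal I -> I x -> I y -> I (x + y).
Proof.
move=> LI Ix Iy; rewrite -[y]opprK.
by case: (LI) => _ IB _; apply: IB => //; apply: left_idealN.
Qed.

Lemma left_ideal_1_full I : left_ideal I -> I 1 -> I = setT.
Proof.
by case=> _ _ IM I1; apply/seteqP; split=> // x _; rewrite -[x]mulr1; apply: IM.
Qed.

(** Zorn's lemma is applied to the sets [X] for which [I `|` X] is a proper
    left ideal, rather than to the proper left ideals containing [I], so that
    [set0], the union of the empty chain, is one of them. *)
Lemma maximal_left_ideal_above I :
  left_ideal I -> ~ I 1 -> exists2 M, maximal_left_ideal M & I `<=` M.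
Proof.
move=> LI I1.
pose P := [set X : set R | left_ideal (I `|` X) /\ ~ (I `|` X) 1].
have [F PF totF|A [[LA A1] maxA]] := @Zorn_bigcup R P.
  have common x y : (I `|` \bigcup_(X in F) X) x ->
      (I `|` \bigcup_(X in F) X) y ->
    (I x /\ I y) \/ exists2 X, F X & (I `|` X) x /\ (I `|` X) y.
    move=> [Ix|[X FX Xx]] [Iy|[Y FY Yy]]; [by left | | | ].
    - by right; exists Y => //; split; [left|right].
    - by right; exists X => //; split; [right|left].
    - by right; case: (totF X Y FX FY) => [XY|YX];
        [exists Y|exists X] => //; split; right; auto.
  have up X x : F X -> (I `|` X) x -> (I `|` \bigcup_(X in F) X) x.
    by move=> FX [Ix|Xx]; [left|right; exists X].
  split; last first.
    by case=> [//|[X FX X1]]; have [_] := PF X FX; apply; right.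
  case: (LI) => I0 IB IM; split; first by left.
  - move=> x y Ux Uy; case: (common x y Ux Uy) => [[Ix Iy]|[X FX [Xx Xy]]].
      by left; apply: IB.
    by apply: (up X) => //; have [[_ XB _] _] := PF X FX; apply: XB.
  - move=> a x Ux; case: (common x x Ux Ux) => [[Ix _]|[X FX [Xx _]]].
      by left; apply: IM.
    by apply: (up X) => //; have [[_ _ XM] _] := PF X FX; apply: XM.
exists (I `|` A); last by move=> x; left.
split=> //; first by move=> E; apply: A1; rewrite E.
move=> K LK IAK; have [K1|K1] := pselect (K 1).
  by right; apply: left_ideal_1_full.
left; apply: contrapT => KIA; apply: (maxA K).
  split; first by move=> x Ax; apply: IAK; right.
  move=> KA; apply: KIA; apply/seteqP; split=> // x Kx.
  by right; apply: KA.
have IK : I `|` K = K.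
  by apply/seteqP; split=> x; [case=> // Ix; apply: IAK; left|right].
by rewrite /P /mkset IK.
Qed.

Lemma jacobsonP z :
  jacobson z <-> forall r, exists c, c * (1 - r * z) = 1.
Proof.
split=> [Jz r|H M maxM].
  (* the principal left ideal of [1 - r z] is the whole ring *)
  pose I := [set y : R | exists c, y = c * (1 - r * z)].
  have LI : left_ideal I.
    split; first by exists 0; rewrite mul0r.
    - by move=> _ _ [c ->] [d ->]; exists (c - d); rewrite mulrBl.
    - by move=> a _ [c ->]; exists (a * c); rewrite mulrA.
  have [[c c1]|I1] := pselect (I 1); first by exists c.
  have [M maxM IM] := maximal_left_ideal_above LI I1.
  have [LM MT _] := maxM; case: MT; apply: left_ideal_1_full => //.
  rewrite -[1](subrK (r * z)); apply: left_idealD => //.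
    by apply: IM; exists 1; rewrite mul1r.
  by have [_ _ MM] := LM; apply: MM; apply: Jz.
have [LM MT max] := maxM; have [M0 MB MM] := LM.
pose K := [set y : R | exists m r, M m /\ y = m + r * z].
have LK : left_ideal K.
  split; first by exists 0, 0; rewrite mul0r addr0.
  - move=> _ _ [m [r [Mm ->]]] [n [s [Mn ->]]]; exists (m - n), (r - s).
    by split; [apply: MB|rewrite mulrBl opprD addrACA].
  - move=> a _ [m [r [Mm ->]]]; exists (a * m), (a * r).
    by split; [apply: MM|rewrite mulrDr mulrA].
have MK : M `<=` K by move=> m Mm; exists m, 0; rewrite mul0r addr0.
have [KM|KT] := max K LK MK.
  by rewrite -KM; exists 0, 1; rewrite mul1r add0r.
have : K 1 by rewrite KT.
case=> m [r [Mm E]]; have [c c1] := H r.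
case: MT; apply: left_ideal_1_full => //.
by rewrite -c1; apply: MM; rewrite E addrK.
Qed.

Lemma jacobson_left_ideal : left_ideal (@jacobson R).
Proof.
split=> [M [[]]//|x y Jx Jy M maxM|a x Jx M maxM].
- by have [[_ MB _] _ _] := maxM; apply: MB; [apply: Jx|apply: Jy].
- by have [[_ _ MM] _ _] := maxM; apply: MM; apply: Jx.
Qed.

Lemma jacobsonMl a x : jacobson x -> jacobson (a * x).
Proof. by have [_ _] := jacobson_left_ideal; apply. Qed.

Lemma jacobson0 : jacobson (0 : R).
Proof. by have [] := jacobson_left_ideal. Qed.

(** [(1 - p) p = 0], and [1 - p] has a left inverse. *)
Lemma idem_jacobson_eq0 (p : R) : idem p -> jacobson p -> p = 0.
Proof.
rewrite /idem expr2 => pp /jacobsonP/(_ 1) [c].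
rewrite mul1r => c1.
by rewrite -[p]mul1r -c1 -mulrA mulrBl mul1r pp subrr mulr0.
Qed.

Lemma left_right_invertible (x c d : R) :
  c * x = 1 -> x * d = 1 -> invertible x.
Proof.
move=> cx xd; exists d; split=> //.
by have -> : d = c by rewrite -[d]mul1r -cx -mulrA xd mulr1.
Qed.

(** A left inverse [c] of [1 - z] equals [1 + c z], which is again of the form
    covered by Jacobson's criterion; so [c] has inverses on both sides. *)
Lemma invertible_1_sub_jacobson z : jacobson z -> invertible (1 - z).
Proof.
move=> Jz; have /jacobsonP H := Jz.
have [c] := H 1; rewrite mul1r => c1.
have cE : c = 1 - (- c) * z.
  by rewrite mulNr opprK -[in 1 + _]c1 mulrBr mulr1 subrK.
have [d] := H (- c); rewrite -cE => dc.
have dE : d = 1 - z by rewrite -[LHS]mulr1 -[X in _ * X = _]c1 mulrA dc mul1r.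
by exists c; split=> //; rewrite -dE.
Qed.

End Jacobson.

(** * Elements nilpotent modulo the Jacobson radical *)

Section Jsharp.
Variable R : pzRingType.
Implicit Types (a e f g j k s u x : R).

Lemma jacobson_jsharp j : jacobson j -> jsharp j.
Proof. by move=> Jj; exists 1%N; rewrite expr1. Qed.

Lemma jsharpMl_comm s j : GRing.comm s j -> jsharp j -> jsharp (s * j).
Proof.
move=> sj [n [n0 Jn]]; exists n; split=> //.
by rewrite exprMn_comm //; apply: jacobsonMl.
Qed.

Lemma jsharpN j : jsharp j -> jsharp (- j).
Proof.
move=> Jj; rewrite -mulN1r; apply: jsharpMl_comm => //.
by rewrite /GRing.comm mulN1r mulrN1.
Qed.

Lemma sqr0_jsharp j : j * j = 0 -> jsharp j.
Proof. by move=> jj; exists 2%N; rewrite expr2 jj; split=> //; apply: jacobson0. Qed.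

Lemma invertibleM s u : invertible s -> invertible u -> invertible (s * u).
Proof.
move=> [s' [ss' s's]] [u' [uu' u'u]]; exists (u' * s'); split.
  by rewrite mulrA -(mulrA s) uu' mulr1.
by rewrite mulrA -(mulrA u') s's mulr1.
Qed.

Lemma invertibleN u : invertible u -> invertible (- u).
Proof. by move=> [v [uv vu]]; exists (- v); rewrite !mulrNN. Qed.

(** [1 - j] divides [1 - j ^+ n] on both sides. *)
Lemma invertible_1_sub_jsharp j : jsharp j -> invertible (1 - j).
Proof.
move=> [n [_ /invertible_1_sub_jacobson [v [nv vn]]]].
have factor : 1 - j ^+ n = (1 - j) * \sum_(i < n) j ^+ i.
  by rewrite -opprB subrX1 -mulNr opprB.
have comm : GRing.comm (1 - j) (\sum_(i < n) j ^+ i).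
  apply: commr_sum => i _; apply: commr_sym; apply: commrB.
    exact: commr1.
  by apply: commr_sym; apply: commrX.
apply: (@left_right_invertible _ _ (v * \sum_(i < n) j ^+ i)
                                   ((\sum_(i < n) j ^+ i) * v)).
  by rewrite -mulrA -comm -factor.
by rewrite mulrA -factor.
Qed.

(** [s + j = s (1 + s^-1 j)], where [s^-1 j] is still nilpotent modulo [J]
    because [s^-1] commutes with [j]. *)
Lemma invertible_add_jsharp s j :
  invertible s -> GRing.comm s j -> jsharp j -> invertible (s + j).
Proof.
move=> [t [st ts]] sj Jj.
have tj : GRing.comm t j.
  by rewrite /GRing.comm -[j in LHS]mulr1 -st !mulrA -(mulrA t) -sj mulrA ts mul1r.
have -> : s + j = s * (1 - (- (t * j))).
  by rewrite opprK mulrDr mulr1 mulrA st mul1r.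
apply: invertibleM; first by exists t.
by apply/invertible_1_sub_jsharp/jsharpN/jsharpMl_comm.
Qed.

Lemma idem1B e : idem e -> idem (1 - e).
Proof.
rewrite /idem !expr2 => ee.
by rewrite mulrBl mul1r mulrBr mulr1 ee subrr subr0.
Qed.

Lemma idem_invertible_eq1 e : idem e -> invertible e -> e = 1.
Proof.
rewrite /idem expr2 => ee [v [ev _]].
by rewrite -[LHS]mulr1 -ev mulrA ee ev.
Qed.

(** * Abelian rings from unique decompositions *)

Lemma corner_sqr0 e x :
  idem e -> (e * x * (1 - e)) * (e * x * (1 - e)) = 0.
Proof.
rewrite /idem expr2 => ee.
have ce : (1 - e) * e = 0 by rewrite mulrBl mul1r ee subrr.
by rewrite -!mulrA (mulrA (1 - e) e) ce mul0r !mulr0.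
Qed.

Lemma idem_corner e x : idem e -> idem (e + e * x * (1 - e)).
Proof.
move=> ee; have nn := corner_sqr0 x ee; move: (ee); rewrite /idem !expr2 => ee2.
have en : e * (e * x * (1 - e)) = e * x * (1 - e) by rewrite !mulrA ee2.
have ne : e * x * (1 - e) * e = 0.
  by rewrite -mulrA mulrBl mul1r ee2 subrr mulr0.
by rewrite mulrDr !mulrDl ee2 en ne nn !addr0.
Qed.

(** Applied to [e] and to [1 - e], the hypothesis says that [e x = e x e] and
    [x e = e x e]. *)
Lemma abelian_of_corner0 :
  (forall e x, idem e -> e = e + e * x * (1 - e)) -> abelian_ring R.
Proof.
move=> H.
have corner0 e x : idem e -> e * x * (1 - e) = 0.
  by move=> /(H e x) /eqP; rewrite -[X in X == _]addr0 (inj_eq (addrI e)) => /eqP.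
move=> e ee x.
have /eqP := corner0 e x ee.
rewrite mulrBr mulr1 subr_eq0 => /eqP ex.
have /eqP := corner0 (1 - e) x (idem1B ee).
rewrite subKr mulrBl mul1r mulrBl subr_eq0 => /eqP xe.
by rewrite /GRing.comm ex xe.
Qed.

Lemma abelian_of_unique_jsharp :
  (forall a, exists! e, idem e /\ exists j, jsharp j /\ a = e + j) ->
  abelian_ring R.
Proof.
move=> H; apply: abelian_of_corner0 => e x ee.
have [f [_ uniq]] := H (e + e * x * (1 - e)).
have E1 : f = e.
  apply: uniq; split=> //; exists (e * x * (1 - e)); split=> //.
  by apply: sqr0_jsharp; apply: corner_sqr0.
have E2 : f = e + e * x * (1 - e).
  apply: uniq; split; first exact: idem_corner.
  by exists 0; rewrite addr0; split=> //; apply: jacobson_jsharp; apply: jacobson0.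
by rewrite -E2.
Qed.

(** [e + (1 + e x (1 - e))] and [(e + e x (1 - e)) + 1] are two clean
    decompositions of the same element. *)
Lemma abelian_of_uniquely_clean : uniquely_clean R -> abelian_ring R.
Proof.
move=> H; apply: abelian_of_corner0 => e x ee.
set n := e * x * (1 - e).
have nn : n * n = 0 by apply: corner_sqr0.
have [p [_ uniq]] := H (e + n + 1).
have E1 : p = (e, 1 + n).
  apply: uniq; split=> //=; last by rewrite -addrA (addrC n).
  by rewrite -[n]opprK; apply/invertible_1_sub_jsharp/jsharpN/sqr0_jsharp.
have E2 : p = (e + n, 1).
  apply: uniq; split=> //=; first exact: idem_corner.
  by exists 1; rewrite mulr1.
by move: E2; rewrite E1 => -[].
Qed.

(** * Abelian [J#]-clean rings have unique decompositions *)

(** On the corner [g R] the element [k] agrees with the unit [1 + j], so that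
    [g = t g k] with [t] the inverse of [1 + j]; iterating,
    [g = t ^+ n g k ^+ n], which lies in [J] for large [n]. *)
Lemma idem_eq0_of_jsharp g j k :
  idem g -> (forall x, GRing.comm g x) -> jsharp j -> jsharp k ->
  g + g * j = g * k -> g = 0.
Proof.
move=> gg gC Jj [n [_ Jkn]] E.
have [t [_ t1]] := invertible_1_sub_jsharp (jsharpN Jj).
have gtk : g = t * g * k.
  rewrite -mulrA -E -[X in X + _]mulr1 -mulrDr mulrA -(gC t) -mulrA.
  by rewrite -[j]opprK t1 mulr1.
apply: idem_jacobson_eq0 => //.
suff -> : g = t ^+ n * g * k ^+ n by apply: jacobsonMl.
elim: {Jkn} n => [|n IH]; first by rewrite !expr0 mul1r mulr1.
by rewrite {1}IH {1}gtk exprSr exprS !mulrA.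
Qed.

(** The idempotent [e (1 - f)] is killed by the previous lemma, with
    [e (1 - f) a] computed from both decompositions. *)
Lemma jsharp_decomposition_le e f j k :
  abelian_ring R -> idem e -> idem f -> jsharp j -> jsharp k ->
  e + j = f + k -> e = e * f.
Proof.
move=> ab ee ff Jj Jk E.
have gg : idem (e * (1 - f)).
  by rewrite /idem exprMn_comm ?(idem1B ff) ?ee //; apply: ab.
have ge : e * (1 - f) * e = e * (1 - f).
  by rewrite -mulrA -(ab e ee) mulrA -expr2 ee.
have gf : e * (1 - f) * f = 0.
  by rewrite -mulrA mulrBl mul1r -expr2 ff subrr mulr0.
suff /eqP : e * (1 - f) = 0 by rewrite mulrBr mulr1 subr_eq0 => /eqP.
apply: (idem_eq0_of_jsharp gg (ab _ gg) Jj Jk).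
by rewrite -[X in X + _]ge -mulrDr E mulrDr gf add0r.
Qed.

Lemma jsharp_decomposition_unique e f j k :
  abelian_ring R -> idem e -> idem f -> jsharp j -> jsharp k ->
  e + j = f + k -> e = f.
Proof.
move=> ab ee ff Jj Jk E.
rewrite (jsharp_decomposition_le ab ee ff Jj Jk E) (ab e ee).
by rewrite -(jsharp_decomposition_le ab ff ee Jk Jj (esym E)).
Qed.

(** * Units modulo the radical *)

(** If [u = g + j] with [g] idempotent, then [g = u - j] is a unit as well,
    so [g = 1]. *)
Lemma invertible_sub1_jsharp u :
  abelian_ring R -> jsharp_clean R -> invertible u -> jsharp (u - 1).
Proof.
move=> ab cl uU; have [g [j [gg Jj uE]]] := cl u.
suff g1 : g = 1 by rewrite uE g1 addrC addKr.
apply: idem_invertible_eq1 => //.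
have -> : g = u + (- j) by rewrite uE addrK.
apply: invertible_add_jsharp => //; last exact: jsharpN.
have -> : j = u - g by rewrite uE addrC addKr.
by apply: commrN; apply: commrB => //; apply: commr_sym; apply: ab.
Qed.

(** Over an abelian ring, being left invertible and being invertible are the
    same on each corner: [z g r] is an idempotent, it is central, and it can
    only be [g]. *)
Lemma abelian_corner_inverse g r z :
  abelian_ring R -> idem g -> g = r * z -> g = z * g * r.
Proof.
move=> ab gg gE; have gC := ab g gg; move: (gg); rewrite /idem expr2 => gg2.
have pp : idem (z * g * r).
  by rewrite /idem expr2 -!mulrA (mulrA r z) -gE (mulrA g g) gg2 (mulrA g g) gg2.
have pz : z * g * r * z = z * g by rewrite -mulrA -gE -mulrA gg2.
have pg : z * g * r * g = z * g * r.
  by rewrite -mulrA -(gC r) mulrA -(mulrA z) gg2.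
by rewrite -pg [X in _ = _ * X]gE mulrA (ab _ pp r) -(mulrA r) pz mulrA -gE gg2.
Qed.

(** On the corner of [g = r (1 - u)], both [u] and [u - 1] would be units;
    hence [g u] would be [0] plus a unit there, and also the identity of the
    corner plus a unit.  Adding [1 - g] turns these into two clean
    decompositions in [R]. *)
Lemma uniquely_clean_no_idem g r u :
  uniquely_clean R -> invertible u -> idem g -> g = r * (1 - u) -> g = 0.
Proof.
move=> uc [v [uv vu]] gg gE.
have ab := abelian_of_uniquely_clean uc; have gC := ab g gg.
have gE' := abelian_corner_inverse ab gg gE.
move: (gg); rewrite /idem expr2 => gg2.
have corner x y : g * x * (g * y) = g -> 
    (g * x + (1 - g)) * (g * y + (1 - g)) = 1.
  move=> E; have cc : (1 - g) * (1 - g) = 1 - g by rewrite -expr2; apply: idem1B.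
  have gc0 : g * (1 - g) = 0 by rewrite mulrBr mulr1 gg2 subrr.
  have cg0 : (1 - g) * g = 0 by rewrite mulrBl mul1r gg2 subrr.
  have cE : g + (1 - g) = 1 by rewrite addrC subrK.
  move: (1 - g) cc gc0 cg0 cE => c cc gc0 cg0 cE.
  by rewrite mulrDr !mulrDl E cc (gC x) -(mulrA x) gc0 mulr0 add0r mulrA cg0
    mul0r addr0.
have gM x y : g * x * (g * y) = g * (x * y).
  by rewrite (gC x) -(mulrA x) (mulrA g g) gg2 mulrA -(gC x) mulrA.
have [p [_ uniq]] := uc (g * u + (1 - g)).
have E1 : p = (0, g * u + (1 - g)).
  apply: uniq; split=> /=; [by rewrite /idem expr2 mul0r| |by rewrite add0r].
  by exists (g * v + (1 - g)); split; apply: corner; rewrite gM ?uv ?vu mulr1.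
have E2 : p = (g, g * (u - 1) + (1 - g)).
  apply: uniq; split=> //=; last by rewrite (addrA g) mulrBr mulr1 (addrC g) subrK.
  exists (g * - r + (1 - g)); split; apply: corner; rewrite gM -opprB mulrNN.
    by rewrite mulrA (gC (1 - u)) -gE'.
  by rewrite -gE gg2.
by move: E2; rewrite E1 => -[].
Qed.

(** By Jacobson's criterion each [1 - r (1 - u)] must be left invertible.
    Decompose [r (1 - u) = e + w]; multiplying by [w^-1 (1 - e)] shows that
    [1 - e] lies in the left ideal generated by [1 - u], so [e = 1] and
    [1 - r (1 - u) = - w]. *)
Lemma invertible_sub1_jacobson u :
  uniquely_clean R -> invertible u -> jacobson (1 - u).
Proof.
move=> uc uU; have ab := abelian_of_uniquely_clean uc.
apply/jacobsonP => r.
have [[e w] [[/= ee [v [wv vw]] E] _]] := uc (r * (1 - u)).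
have cc := idem1B ee.
have cE : 1 - e = v * (1 - e) * r * (1 - u).
  rewrite -mulrA E -mulrA mulrDr mulrBl mul1r -expr2 ee subrr add0r.
  by rewrite (ab _ cc w) mulrA vw mul1r.
have /eqP := uniquely_clean_no_idem uc uU cc cE.
rewrite subr_eq0 => /eqP e1.
by exists (- v); rewrite E -e1 opprD addrA subrr add0r mulrNN.
Qed.

End Jsharp.

Theorem theorem2p26 (R : pzRingType) :
  [<-> abelian_ring R /\ jsharp_clean R;
       forall a : R, exists! e : R,
         idem e /\ exists j : R, jsharp j /\ a = e + j;
       uniquely_clean R].
Proof.
tfae.
- move=> [ab cl] a; have [e [j [ee Jj aE]]] := cl a.
  exists e; split; first by split=> //; exists j.
  move=> f [ff [k [Jk aE']]].
  by apply: (jsharp_decomposition_unique ab ee ff Jj Jk); rewrite -aE.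
- move=> H; have ab := abelian_of_unique_jsharp H.
  have cl : jsharp_clean R.
    by move=> a; have [e [[ee [j [Jj aE]]] _]] := H a; exists e, j.
  move=> a.
  have [e [j [ee Jj aE]]] := cl (a - 1).
  have uU : invertible (1 + j).
    by rewrite -[j]opprK; apply/invertible_1_sub_jsharp/jsharpN.
  have aE1 : a = e + (1 + j) by rewrite (addrC 1) addrA -aE subrK.
  exists (e, 1 + j); split=> //= -[f v] [/= ff vU aE2].
  have ef : e = f.
    apply: (jsharp_decomposition_unique ab ee ff Jj
      (invertible_sub1_jsharp ab cl vU)).
    by rewrite addrA -aE2 aE.
  by congr pair=> //; apply: (addrI e); rewrite -aE1 aE2 ef.
- move=> uc; split; first exact: abelian_of_uniquely_clean.
  move=> a; have [[e u] [[/= ee uU aE] _]] := uc (a - 1).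
  exists e, (1 - (- u)); split=> //.
    by apply: jacobson_jsharp; apply: invertible_sub1_jacobson; last exact: invertibleN.
  by rewrite opprK (addrC 1) addrA -aE subrK.
Qed.
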